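(* Every generalized sticky random walk $S(n,p,\lambda)$ corresponds to an $n$-step random walk on a $p\lambda$-spectral expander with $p$ vertices: for all integers $n\ge1$, $p\ge2$ and all $\lambda$ with $0\le\lambda\le\frac1p$, there is a $p\lambda$-spectral expander on the vertex set $\mathbb{Z}_p$ such that $S(n,p,\lambda)$ is the distribution of the sequence of $n$ vertices visited by the random walk on this expander started at a uniformly random vertex.
   Context: $\mathbb{Z}_p=\{0,\dots,p-1\}$. The generalized sticky random walk $S(n,p,\lambda)$ is the distribution on strings $s_1\cdots s_n\in\mathbb{Z}_p^n$ generated by a Markov chain on $\mathbb{Z}_p$: the first symbol is uniform on $\mathbb{Z}_p$, and at each subsequent step the chain stays at its current state with probability $\frac1p+(p-1)\lambda$ and moves to each particular other state with probability $\frac1p-\lambda$. A $\mu$-spectral expander on a finite vertex set $V$ is a regular undirected graph on $V$ (edge weights and self-loops allowed) whose degree-normalized adjacency matrix, i.e. its random walk matrix, is a symmetric doubly stochastic matrix with eigenvalues $1=\lambda_1\ge\lambda_2\ge\cdots\ge\lambda_{|V|}$ satisfying $\max_{i\ne1}|\lambda_i|\le\mu$. The random walk on it moves from $u$ to $v$ with probability given by the $(u,v)$ entry of this matrix. *)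

(* Defs.v *)
From mathcomp Require Import all_boot all_order all_algebra.
From mathcomp Require Import reals.

Set Implicit Arguments.
Unset Strict Implicit.
Unset Printing Implicit Defensive.

Import Order.TTheory GRing.Theory Num.Theory.
Local Open Scope ring_scope.

Section MarkovChains.
Variables (R : realType) (V : finType).

Fixpoint path_prob (P : V -> V -> R) (x : V) (s : seq V) : R :=
  if s is y :: s' then P x y * path_prob P y s' else 1.

Definition chain_prob (q : V -> R) (P : V -> V -> R) (s : seq V) : R :=
  if s is x :: s' then q x * path_prob P x s' else 1.

(* Probability mass function of the first n states of the Markov chain on V
   with initial distribution q and transition probabilities P. *)
Definition chain_law (n : nat) (q : V -> R) (P : V -> V -> R) :
    {ffun n.-tuple V -> R} := [ffun s : n.-tuple V => chain_prob q P s].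

Definition uniform (x : V) : R := #|V|%:R^-1.

Definition is_dist (T : finType) (f : T -> R) : Prop :=
  (forall x, 0 <= f x) /\ \sum_x f x = 1.

End MarkovChains.

Arguments uniform {R V} x.

(* Z_p is 'I_p: only the set {0, ..., p-1} matters, not its arithmetic. *)
Definition sticky_trans (R : realType) (p : nat) (lam : R) (x y : 'I_p) : R :=
  if y == x then p%:R^-1 + (p%:R - 1) * lam else p%:R^-1 - lam.

Definition sticky_walk (R : realType) (n p : nat) (lam : R) :
    {ffun n.-tuple 'I_p -> R} :=
  chain_law n uniform (sticky_trans lam).

(* Undirected graphs with nonnegative edge weights; weight u u is the weight
   of the self-loop at u, and weight u v = 0 means that there is no edge. *)
Record wgraph (R : realType) (V : finType) := WGraph {
  weight : V -> V -> R;
  weight_ge0 : forall u v, 0 <= weight u v;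
  weight_sym : forall u v, weight u v = weight v u
}.

Section Expanders.
Variables (R : realType) (V : finType).
Implicit Types G : wgraph R V.

Definition degree G (u : V) : R := \sum_v weight G u v.

Definition regular G : Prop := forall u v, degree G u = degree G v.

Definition rw_trans G (u v : V) : R := weight G u v / degree G u.

(* The random walk matrix, with V enumerated as 'I_#|V|. *)
Definition rw_mx G : 'M[R]_#|V| :=
  \matrix_(i, j) rw_trans G (enum_val i) (enum_val j).

Definition doubly_stochastic m (A : 'M[R]_m) : Prop :=
  [/\ forall i j, 0 <= A i j,
      forall i, \sum_j A i j = 1
    & forall j, \sum_i A i j = 1].

(* s lists the eigenvalues of A with their algebraic multiplicities, in
   nonincreasing order. *)
Definition spectrum m (A : 'M[R]_m) (s : seq R) : Prop :=
  char_poly A = \prod_(l <- s) ('X - l%:P) /\ sorted >=%R s.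

(* An edgeless graph has zero random walk matrix (division by zero), so
   double stochasticity also forces the common degree to be positive. *)
Definition spectral_expander (mu : R) G : Prop :=
  [/\ regular G,
      (rw_mx G)^T = rw_mx G,
      doubly_stochastic (rw_mx G)
    & exists s : seq R,
        [/\ spectrum (rw_mx G) (1 :: s) & forall l, l \in s -> `|l| <= mu]].

Definition random_walk (n : nat) G : {ffun n.-tuple V -> R} :=
  chain_law n uniform (rw_trans G).

End Expanders.

Lemma path_prob_ge0 (R : realType) (V : finType) (P : V -> V -> R) x s :
  (forall u, is_dist (P u)) -> 0 <= path_prob P x s.
Proof.
move=> dP; elim: s x => [|y s IHs] x /=; first exact: ler01.
by rewrite mulr_ge0 //; case: (dP x).
Qed.

Lemma path_prob_sum (R : realType) (V : finType) (P : V -> V -> R) n x :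
  (forall u, is_dist (P u)) -> \sum_(s : n.-tuple V) path_prob P x s = 1.
Proof.
move=> dP; elim: n x => [|n IHn] x.
  by rewrite (bigD1 [tuple]) //= big1 ?addr0 // => s; rewrite tuple0.
rewrite (reindex (fun u : V * n.-tuple V => [tuple of u.1 :: u.2])) /=.
  rewrite -(pair_bigA _ (fun y (s : n.-tuple V) => P x y * path_prob P y s)) /=.
  rewrite -(dP x).2; apply: eq_bigr => y _.
  by rewrite -mulr_sumr IHn mulr1.
exists (fun t : n.+1.-tuple V => (thead t, [tuple of behead t])) => [[y s]|t] _ /=.
  by rewrite theadE; congr (_, _); apply: val_inj.
by rewrite -tuple_eta.
Qed.

Lemma chain_law_dist (R : realType) (V : finType) n q (P : V -> V -> R) :
  is_dist q -> (forall u, is_dist (P u)) -> is_dist (chain_law n q P).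
Proof.
move=> dq dP; split=> [s|].
  rewrite ffunE /chain_prob; case: (tval s) => [|x s']; first exact: ler01.
  by rewrite mulr_ge0 ?path_prob_ge0 //; case: dq.
case: n => [|n].
  rewrite (bigD1 [tuple]) //= big1 ?addr0 ?ffunE // => s.
  by rewrite tuple0.
under eq_bigr do rewrite ffunE /chain_prob.
rewrite (reindex (fun u : V * n.-tuple V => [tuple of u.1 :: u.2])) /=.
  rewrite -(pair_bigA _ (fun y (s : n.-tuple V) => q y * path_prob P y s)) /=.
  rewrite -dq.2; apply: eq_bigr => y _.
  by rewrite -mulr_sumr path_prob_sum // mulr1.
exists (fun t : n.+1.-tuple V => (thead t, [tuple of behead t])) => [[y s]|t] _ /=.
  by rewrite theadE; congr (_, _); apply: val_inj.
by rewrite -tuple_eta.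
Qed.

Lemma uniform_dist (R : realType) p : (0 < p)%N ->
  is_dist (uniform : 'I_p -> R).
Proof.
move=> p0; split=> [x|]; first by rewrite invr_ge0.
by rewrite sumr_const -[_ *+ _]mulr_natl mulfV // card_ord pnatr_eq0 -lt0n.
Qed.

Lemma sticky_trans_dist (R : realType) p (lam : R) (x : 'I_p) :
  0 <= lam -> lam <= p%:R^-1 -> is_dist (sticky_trans lam x).
Proof.
move=> l0 l1; have p0 : (0 < p)%N by apply: leq_trans (ltn_ord x).
split=> [y|]; rewrite /sticky_trans.
  case: ifP => _; last by rewrite subr_ge0.
  by rewrite addr_ge0 ?invr_ge0 // mulr_ge0 // subr_ge0 ler1n.
rewrite (bigD1 x) //= eqxx.
under eq_bigr => y /negbTE -> do [].
rewrite sumr_const cardC1 card_ord -[(_ - lam) *+ _]mulr_natl -subn1 natrB //.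
rewrite mulrBr addrACA subrr addr0 -{1}[_^-1]mul1r -mulrDl addrC subrK.
by rewrite mulfV // pnatr_eq0 -lt0n.
Qed.

Lemma sticky_walk_dist (R : realType) n p (lam : R) : (0 < p)%N ->
  0 <= lam -> lam <= p%:R^-1 -> is_dist (sticky_walk n p lam).
Proof.
move=> p0 l0 l1; apply: chain_law_dist; first exact: uniform_dist.
by move=> u; apply: sticky_trans_dist.
Qed.

(* Main.v *)
Require Import Defs.
From mathcomp Require Import all_boot all_order all_algebra.
From mathcomp Require Import reals.

Import Order.TTheory GRing.Theory Num.Theory.
Local Open Scope ring_scope.

(** The sticky chain is itself the expander: weight the pair (x, y) by the
    transition probability x -> y.  These weights are symmetric and every
    vertex has degree 1, so the random walk on the weighted graph has exactly
    the sticky transition probabilities, whence the two laws coincide.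

    Its matrix is a I + b J, where J is the all-ones matrix, b = 1/p - lam and
    a = p lam.  Since b J has rank at most one, the matrix determinant lemma
    ([det_scalar_sub_rank1]) gives the characteristic polynomial
    (X - (a + p b)) (X - a)^(p-1) ([char_poly_scalar_const]).  As
    a + p b = 1, the spectrum is 1 followed by p - 1 copies of p lam, which lies
    between 0 and 1. *)

(** The matrix determinant lemma.  The block matrix with rows (1, v) and
    (u, c I) is eliminated in two ways: on the left, clearing u exposes the Schur
    complement c I - u v; on the right, multiplying its first column by c and
    subtracting leaves the triangular matrix with diagonal blocks c - v u and
    c I.  The extra factor c comes from the second elimination, and makes the
    identity hold without inverting c. *)
Lemma det_scalar_sub_rank1 (R : comNzRingType) m (c : R)
    (u : 'cV[R]_m) (v : 'rV[R]_m) :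
  \det (c%:M - u *m v) * c = (c - (v *m u) 0 0) * c ^+ m.
Proof.
pose M := block_mx 1%:M v u (c%:M) : 'M_(1 + m).
have detM : \det M = \det (c%:M - u *m v).
  have -> : M = block_mx 1%:M 0 u 1%:M *m block_mx 1%:M v 0 (c%:M - u *m v).
    rewrite mulmx_block !mul1mx !mul0mx !mulmx1 !addr0.
    by rewrite addrC subrK.
  by rewrite det_mulmx det_lblock det_ublock !det1 !mul1r.
have Mtriang : M *m block_mx c%:M 0 (- u) 1%:M
             = block_mx (c%:M - v *m u) v 0 c%:M.
  rewrite mulmx_block !mul1mx !mulmx1 !mulmx0 !add0r !mulmxN.
  by rewrite mul_mx_scalar mul_scalar_mx subrr.
have := congr1 determinant Mtriang.
rewrite det_mulmx detM det_lblock det_ublock det1 mulr1 !det_scalar expr1 => ->.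
by rewrite det_mx11 !mxE mulr1n.
Qed.

Lemma char_poly_scalar_const (R : idomainType) m (a b : R) :
  char_poly (a%:M + const_mx b : 'M_m.+1)
  = ('X - (a + b *+ m.+1)%:P) * ('X - a%:P) ^+ m.
Proof.
have Xa0 : 'X - a%:P != 0 by rewrite polyXsubC_eq0.
(* char_poly is det (X I - A), and X I - (a I + b J) = (X - a) I - u v with
   u constant b and v constant 1. *)
pose u : 'cV[{poly R}]_m.+1 := const_mx b%:P.
pose v : 'rV[{poly R}]_m.+1 := const_mx 1.
have -> : char_poly (a%:M + const_mx b : 'M_m.+1)
        = \det (('X - a%:P)%:M - u *m v).
  congr (determinant _); apply/matrixP=> i j; rewrite !mxE big_ord1 !mxE mulr1.
  by rewrite polyCD polyCMn opprD addrA mulrnBl.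
apply: (mulIf Xa0); rewrite det_scalar_sub_rank1 -mulrA -exprSr; congr (_ * _).
rewrite mxE; under eq_bigr do rewrite !mxE mul1r.
by rewrite sumr_const card_ord polyCD polyCMn opprD addrA.
Qed.

Lemma sticky_trans_sym (R : realType) p (lam : R) (x y : 'I_p) :
  sticky_trans lam x y = sticky_trans lam y x.
Proof. by rewrite /sticky_trans eq_sym. Qed.

Theorem theorem7p2 (R : realType) (n p : nat) (lam : R)
    (hn : (1 <= n)%N) (hp : (2 <= p)%N)
    (hlam0 : 0 <= lam) (hlam1 : lam <= p%:R^-1) :
  exists G : wgraph R 'I_p,
    spectral_expander (p%:R * lam) G /\
    sticky_walk n p lam = random_walk n G.
Proof.
have p0 : (0 < p)%N by exact: ltnW.
have pR0 : p%:R != 0 :> R by rewrite pnatr_eq0 -lt0n.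
have distT (x : 'I_p) := sticky_trans_dist x hlam0 hlam1.
pose G : wgraph R 'I_p :=
  WGraph (fun u => (distT u).1) (@sticky_trans_sym R p lam).
have deg1 u : degree G u = 1 := (distT u).2.
have transE u v : rw_trans G u v = sticky_trans lam u v.
  by rewrite /rw_trans deg1 divr1.
have mxsym : (rw_mx G)^T = rw_mx G.
  by apply/matrixP=> i j; rewrite !mxE !transE sticky_trans_sym.
have rowsum i : \sum_j rw_mx G i j = 1.
  under eq_bigr do rewrite mxE transE.
  rewrite -(big_enum_val (sticky_trans lam (enum_val i))) -(distT (enum_val i)).2.
  exact: eq_bigl.
exists G; split; last first.
  apply/ffunP=> s; rewrite !ffunE; case: (tval s) => //= x s'; congr (_ * _).
  by elim: s' x => //= y s' IHs x; rewrite transE IHs.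
split=> //.
- by move=> u v; rewrite !deg1.
- split=> // [i j|j]; first by rewrite mxE transE; case: (distT (enum_val i)).
  by rewrite -(rowsum j); apply: eq_bigr => i _; rewrite -{1}mxsym mxE.
have pl0 : 0 <= p%:R * lam by rewrite mulr_ge0.
have pl1 : p%:R * lam <= 1.
  by have := ler_wpM2l (ler0n R p) hlam1; rewrite mulfV.
exists (nseq p.-1 (p%:R * lam)); split; last first.
  by move=> l /nseqP[-> _]; rewrite ger0_norm.
split; last first.
  case: (p.-1) => //= k; rewrite pl1 /=.
  by elim: k => //= k ->; rewrite lexx.
have mxE' : rw_mx G = (p%:R * lam)%:M + const_mx (p%:R^-1 - lam).
  apply/matrixP=> i j; rewrite !mxE transE /sticky_trans (inj_eq enum_val_inj).
  rewrite eq_sym; case: eqP => _; last by rewrite mulr0n add0r.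
  by rewrite mulr1n mulrBl mul1r addrCA.
have cardp : #|'I_p| = p.-1.+1 by rewrite card_ord prednK.
rewrite mxE'; move: #|_| cardp => m ->.
rewrite char_poly_scalar_const prednK // big_cons big_nseq -Monoid.iteropE.
have -> : p%:R * lam + (p%:R^-1 - lam) *+ p = 1.
  by rewrite -[(_ - lam) *+ p]mulr_natl mulrBr mulfV // addrC subrK.
by [].
Qed.
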